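(* Assume there is a proper class of supercompact cardinals. Then for every ring $R$ and every set $\mathcal{S}$ of $R$-modules, the class ${}^\perp\mathcal{S}$ is a Kaplansky class.
   Context: The background theory is ZFC. Modules are left $R$-modules. For a class (in particular, a set) $\mathcal{C}$ of $R$-modules, ${}^\perp\mathcal{C}=\{X : \mathrm{Ext}^1_R(X,C)=0 \text{ for all } C\in\mathcal{C}\}$. A class $\mathcal{C}$ of modules is a Kaplansky class if there exists a cardinal $\kappa$ such that, for every $C\in\mathcal{C}$ and every subset $X\subseteq C$ with $|X|<\kappa$, there is a $<\kappa$-presented submodule $C_0$ of $C$ such that $X\subseteq C_0$ and both $C_0$ and $C/C_0$ are in $\mathcal{C}$. A module is $<\kappa$-presented if it has a presentation with fewer than $\kappa$ generators and fewer than $\kappa$ relations. *)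

(* Defs.v *)
From HB Require Import structures.
From mathcomp Require Import all_boot all_order all_algebra.
From mathcomp Require Import boolp classical_sets functions cardinality filter.

Set Implicit Arguments.
Unset Strict Implicit.
Unset Printing Implicit Defensive.

Import GRing.Theory.
Local Open Scope classical_set_scope.
Local Open Scope ring_scope.
Local Open Scope quotient_scope.
Local Open Scope card_scope.

(* The sets of ZFC are the types in the universe that contains the carriers of
   all rings and modules; choiceType ranges over exactly these types, since
   under the axioms of boolp each of them has a choice structure.  A cardinal
   kappa is given by a type K of that cardinality.  Classes of modules are
   predicates on lmodType R. *)

Definition card_lt (T U : Type) (A : set T) (B : set U) : Prop :=
  A #<= B /\ ~ (B #<= A).
Notation "A '#<' B" := (card_lt A B) (at level 70) : card_scope.

(* The ZFC definition of supercompactness: for every set A with |A| >= kappa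
   there is a normal measure on P_kappa(A), that is, a fine, normal,
   kappa-complete ultrafilter. *)
Section Supercompact.
Variable K : choiceType.

Definition Pkappa (A : choiceType) : Type := {x : set A | x #< [set: K]}.

Record normal_measure (A : choiceType) (U : set_system (Pkappa A)) : Prop := {
  measure_ultra : UltraFilter U ;
  measure_complete : forall G : set_system (Pkappa A),
    G #< [set: K] -> G `<=` U -> U (\bigcap_(X in G) X) ;
  measure_fine : forall a : A, U [set x | sval x a] ;
  measure_normal : forall f : Pkappa A -> A,
    U [set x | sval x (f x)] -> exists a : A, U [set x | f x = a]
}.

Definition supercompact : Prop :=
  ~ countable [set: K] /\
  forall A : choiceType, [set: K] #<= [set: A] ->
    exists U : set_system (Pkappa A), normal_measure U.

End Supercompact.

Definition proper_class_of_supercompacts : Prop :=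
  forall A : choiceType, exists K : choiceType,
    supercompact K /\ [set: A] #< [set: K].

Section SubQuotient.
Variables (R : pzRingType) (M : lmodType R) (N : submodClosed M).

Definition submod : Type := {x : M | x \in N}.
HB.instance Definition _ := SubChoice.on submod.
HB.instance Definition _ := [SubChoice_isSubLmodule of submod by <:].

Fact submod_zmod_closed : zmod_closed (mem N).
Proof. exact: GRing.submod_closedB (submodClosedP N). Qed.

Definition submod_zmod : zmodClosed M :=
  HB.pack (fun x : M => x \in N)
    (GRing.isZmodClosed.Build M (fun x : M => x \in N) submod_zmod_closed).

Local Notation Q := (Quotient.quot submod_zmod).

Definition quot_scale (a : R) (u : Q) : Q := \pi_Q (a *: repr u).

Fact quot_scale_pi a x : quot_scale a (\pi_Q x) = \pi_Q (a *: x).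
Proof.
apply/eqP; rewrite /quot_scale -Quotient.idealrBE -scalerBr.
have : repr (\pi_Q x) - x \in submod_zmod.
  by rewrite Quotient.idealrBE reprK.
exact: (@rpredZ _ _ N).
Qed.

Fact quot_piD (x y : M) : \pi_Q (x + y) = \pi_Q x + \pi_Q y :> Q.
Proof. exact: (Quotient.pi_add submod_zmod x y). Qed.

Fact quot_scaleA a b u : quot_scale a (quot_scale b u) = quot_scale (a * b) u.
Proof. by rewrite -[u]reprK (quot_scale_pi b) !quot_scale_pi scalerA. Qed.

Fact quot_scale1 : left_id 1 quot_scale.
Proof. by move=> u; rewrite -[u]reprK quot_scale_pi scale1r. Qed.

Fact quot_scaleDr : right_distributive quot_scale +%R.
Proof.
move=> a u v.
by rewrite -[u]reprK -[v]reprK -quot_piD !quot_scale_pi scalerDr quot_piD.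
Qed.

Fact quot_scaleDl u : {morph quot_scale^~ u : a b / a + b}.
Proof.
by move=> a b; rewrite -[u]reprK !quot_scale_pi scalerDl quot_piD.
Qed.

Definition quotmod : Type := Q.
HB.instance Definition _ := GRing.Zmodule.on quotmod.
HB.instance Definition _ := GRing.Zmodule_isLmodule.Build R quotmod
  quot_scaleA quot_scale1 quot_scaleDr quot_scaleDl.

End SubQuotient.

Section Ext.
Variables (R : pzRingType) (X C : lmodType R).

Record extension := Extension {
  ext_mod : lmodType R ;
  ext_in : {linear C -> ext_mod} ;
  ext_out : {linear ext_mod -> X} ;
  ext_in_inj : injective ext_in ;
  ext_out_surj : forall x, exists e, ext_out e = x ;
  ext_exact : forall e, ext_out e = 0 <-> exists c, ext_in c = e
}.

(* Such an f is automatically bijective, by the five lemma. *)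
Definition ext_congr (E E' : extension) : Prop :=
  exists f : {linear ext_mod E -> ext_mod E'},
    (forall c, f (ext_in E c) = ext_in E' c) /\
    (forall e, ext_out E' (f e) = ext_out E e).

Definition split_in (c : C) : (C * X)%type := (c, 0).
Definition split_out (e : (C * X)%type) : X := e.2.

Fact split_in_linear : linear split_in.
Proof.
move=> a c d; rewrite /split_in -[RHS]/(a *: c + d, a *: 0 + 0).
by rewrite scaler0 addr0.
Qed.
HB.instance Definition _ :=
  GRing.isLinear.Build R C (C * X)%type _ split_in split_in_linear.

Fact split_out_linear : linear split_out.
Proof. by []. Qed.
HB.instance Definition _ :=
  GRing.isLinear.Build R (C * X)%type X _ split_out split_out_linear.

Fact split_in_inj : injective split_in.
Proof. by move=> c d []. Qed.

Fact split_out_surj x : exists e, split_out e = x.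
Proof. by exists (0, x). Qed.

Fact split_exact e : split_out e = 0 <-> exists c, split_in c = e.
Proof.
by case: e => c x; split=> [/= ->|[d [_ <-]]] //; exists c.
Qed.

Definition split_extension : extension :=
  @Extension (C * X)%type split_in split_out
    split_in_inj split_out_surj split_exact.

(* Yoneda's Ext^1_R(X, C): the congruence classes of extensions of X by C, the
   zero element being the class of the split extension. *)
Definition Ext1 : Type :=
  {P : extension -> Prop | exists E, P = ext_congr E}.

Definition Ext1_zero : Ext1 :=
  exist _ (ext_congr split_extension)
    (ex_intro _ split_extension (erefl _)).

End Ext.
Arguments ext_in_inj {R X C} E [x1 x2] _ : rename.
Arguments ext_out_surj {R X C} E x : rename.
Arguments ext_exact {R X C} E e : rename.

Definition perp (R : pzRingType) (P : lmodType R -> Prop) :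
    lmodType R -> Prop :=
  fun X => forall C, P C -> forall e : Ext1 X C, e = Ext1_zero X C.

Section Presentations.
Variable R : pzRingType.

Definition submod_gen (M : lmodType R) (A : set M) : set M :=
  [set x | forall N : submodClosed M, A `<=` [set` N] -> x \in N].

Definition lin_indep (M : lmodType R) (B : set M) : Prop :=
  forall (s : seq M) (a : M -> R), uniq s -> [set` s] `<=` B ->
    \sum_(x <- s) a x *: x = 0 -> {in s, forall x, a x = 0}.

Definition is_basis (M : lmodType R) (B : set M) : Prop :=
  submod_gen B = [set: M] /\ lin_indep B.

Definition lt_presented (K : choiceType) (M : lmodType R) : Prop :=
  exists (F : lmodType R) (B : set F) (p : {linear F -> M}) (L : set F),
    [/\ is_basis B, B #< [set: K], range p = [set: M], L #< [set: K] &
        [set x | p x = 0] = submod_gen L].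

(* kappa is required to be infinite: for kappa = 0 the condition would hold
   vacuously, and for kappa = 1 with the zero submodule. *)
Definition kaplansky_class (P : lmodType R -> Prop) : Prop :=
  exists2 K : choiceType, infinite_set [set: K] &
    forall C : lmodType R, P C -> forall X : set C, X #< [set: K] ->
      exists N : submodClosed C,
        [/\ X `<=` [set` N], lt_presented K (submod N),
            P (submod N) & P (quotmod N)].

End Presentations.

(* Main.v *)
From HB Require Import structures.
Require Import Defs.
From mathcomp Require Import all_boot all_order all_algebra.
From mathcomp Require Import boolp classical_sets functions cardinality filter.

(* Let kappa be supercompact and larger than R and all the targets S i.  For a
   normal measure on the P_kappa of a set containing C, almost every x meets C
   in a submodule N_x.  A family of maps into S i, one on each N_x, is almost
   everywhere the restriction of a single map on C: kappa-completeness
   provides its values and normality makes it agree with the family.  Hence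
   - almost every N_x has the property that all maps N_x -> S i extend to C
     (otherwise glue counterexamples), which together with Ext(C, S i) = 0
     gives Ext(C / N_x, S i) = 0;
   - the same gluing, applied to maps on the relation modules of the canonical
     free covers of the N_x, transfers Ext(C, S i) = 0 to N_x. *)

Set Implicit Arguments.
Unset Strict Implicit.
Unset Printing Implicit Defensive.

Import GRing.Theory.
Local Open Scope classical_set_scope.
Local Open Scope ring_scope.
Local Open Scope quotient_scope.
Local Open Scope card_scope.

(** * Comparing cardinalities *)

Lemma card_lt_le (T U V : Type) (A : set T) (B : set U) (C : set V) :
  A #<= B -> B #< C -> A #< C.
Proof.
move=> AB [BC nCB]; split; first exact: card_le_trans AB BC.
by move=> CA; apply: nCB; apply: card_le_trans CA AB.
Qed.

Lemma card_le_inj (T U : Type) (f : T -> U) (A : set T) (B : set U) :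
  (forall x y, A x -> A y -> f x = f y -> x = y) -> f @` A `<=` B -> A #<= B.
Proof.
move=> f_inj fAB; apply: card_le_trans (subset_card_le fAB).
have /card_eqPle[] // : f @` A #= A.
by apply: inj_card_eq => x y /[!inE]; exact: f_inj.
Qed.

(** * Completeness and normality of a measure on P_kappa(A) *)

Section NormalMeasure.
Variables (K A : choiceType) (U : set_system (Pkappa K A)).
Hypothesis nU : normal_measure U.

#[local] Instance measure_filter : ProperFilter U.
Proof. by case: (measure_ultra nU). Qed.

Lemma measure_all (J : Type) (D : set J) (P : J -> Pkappa K A -> Prop) :
    D #< [set: K] -> (forall j, D j -> U [set x | P j x]) ->
  U [set x | forall j, D j -> P j x].
Proof.
move=> D_lt DP.
have : U (\bigcap_(X in (fun j => [set x | P j x]) @` D) X).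
  apply: (measure_complete nU); last by move=> _ [j Dj <-]; exact: DP.
  exact: card_lt_le (card_image_le _ _) D_lt.
by apply: filterS => x Px j Dj; apply: (Px [set x | P j x]); exists j.
Qed.

(** If every fibre were null, completeness would make the intersection of their complements, which
    is empty, a measure-one set. *)
Lemma measure_const (S : Type) (f : Pkappa K A -> S) :
  [set: S] #< [set: K] -> exists s, U [set x | f x = s].
Proof.
move=> S_lt; apply: contrapT => nf.
have : U [set x | forall s, [set: S] s -> f x <> s].
  apply: measure_all S_lt _ => s _.
  case: (in_ultra_setVsetC [set x | f x = s] (measure_ultra nU)) => //.
  by move=> Ufs; case: nf; exists s.
by move=> /filter_ex[x /(_ (f x) I)].
Qed.

(** Diagonal intersections. Were the failures of measure one, choosing in [x] an index of failure
    would be regressive, hence constantly some [a] on a measure-one set, against the hypothesis on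
    [P a]. *)
Lemma measure_diag (P : A -> Pkappa K A -> Prop) :
  (forall a, U [set x | P a x]) -> U [set x | forall a, sval x a -> P a x].
Proof.
move=> UP.
case: (in_ultra_setVsetC [set x | forall a, sval x a -> P a x]
  (measure_ultra nU)) => // nUP.
have bad x : (~` [set x | forall a, sval x a -> P a x]) x ->
    exists a, sval x a /\ ~ P a x.
  by move=> /= nPx; apply: contrapT => nex; apply: nPx => a xa;
    apply: contrapT => nPa; apply: nex; exists a.
(* [a0] only serves as the value of [f] where there is no failure. *)
have [x0 /bad[a0 _]] := filter_ex nUP.
have /choice[f fP] x : exists a, (exists a, sval x a /\ ~ P a x) ->
    sval x a /\ ~ P a x.
  by have [[a xa]|nx] := pselect (exists a, sval x a /\ ~ P a x);
    [exists a | exists a0].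
have [|a Ua] := measure_normal nU (f := f).
  by apply: filterS nUP => x /bad/fP[].
have : U [set x | [/\ (~` [set x | forall a, sval x a -> P a x]) x,
    f x = a & P a x]] by apply: filterS3 (nUP) (Ua) (UP a).
by move=> /filter_ex[x [/bad/fP[_ nPf] <-]].
Qed.

End NormalMeasure.

(** * Linear maps, submodules and quotient projections *)

Definition linear_map (R : pzRingType) (V W : lmodType R) (f : V -> W)
    (f_lin : linear f) : {linear V -> W} :=
  HB.pack f (GRing.isLinear.Build R V W _ f f_lin).

Definition submod_of (R : pzRingType) (M : lmodType R) (P : pred M)
    (P_closed : submod_closed P) : submodClosed M :=
  HB.pack P (GRing.isSubmodClosed.Build R M P P_closed).

Section QuotientProjection.
Variables (R : pzRingType) (M : lmodType R) (N : submodClosed M).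

Let pi (x : M) : quotmod N := \pi_(Quotient.quot (submod_zmod N)) x.

Fact quot_proj_linear : linear pi.
Proof.
by move=> a u v; rewrite -[a *: pi u]/(quot_scale _ _) quot_scale_pi -quot_piD.
Qed.

Definition quot_proj : {linear M -> quotmod N} := linear_map quot_proj_linear.

Lemma quot_proj_repr u : quot_proj (repr u) = u.
Proof. exact: reprK. Qed.

Lemma quot_proj_eq u v : quot_proj u = quot_proj v <-> u - v \in N.
Proof.
by split; rewrite -[u - v \in N]/(u - v \in submod_zmod N)
  Quotient.idealrBE => /eqP.
Qed.

End QuotientProjection.

(** * Free modules as finitely supported functions *)

Section FreeModule.
Variables (R : pzRingType) (X : choiceType).

Let finsupp : pred (X -> R^o) := fun f => `[< finite_set [set x | f x != 0] >].

Fact finsupp_submod_closed : submod_closed finsupp.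
Proof.
split=> [|a f g /asboolP fin_f /asboolP fin_g].
  apply/asboolP; rewrite (_ : mkset _ = set0) //.
  by apply/seteqP; split=> x //= /eqP /(_ erefl).
apply/asboolP; apply: (@sub_finite_set _ _ ([set x | f x != 0] `|`
  [set x | g x != 0])); last by rewrite finite_setU.
move=> x /=; apply: contraPP => /not_orP[].
move=> /negP /[!negbK] /eqP fx /negP /[!negbK] /eqP gx; apply/negP.
by rewrite negbK -[(_ + _) x]/(a *: f x + g x) fx gx scaler0 addr0.
Qed.

Definition free_closed : submodClosed (X -> R^o) :=
  submod_of finsupp_submod_closed.

Definition free : lmodType R := submod free_closed.

Definition free_coef (f : free) (x : X) : R := val f x.

Lemma free_coefP a (f g : free) x :
  free_coef (a *: f + g) x = a * free_coef f x + free_coef g x.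
Proof. by []. Qed.

Lemma free_ext (f g : free) : free_coef f =1 free_coef g -> f = g.
Proof. by move=> fg; apply/val_inj/funext. Qed.

Fact free_delta_subproof (x : X) :
  (fun y => (y == x)%:R : R^o) \in free_closed.
Proof.
apply/asboolP/(sub_finite_set _ (finite_set1 x)) => y /=.
by case: (eqVneq y x) => // _ /negP []; apply/eqP.
Qed.

Definition free_delta (x : X) : free :=
  exist (fun f => f \in free_closed) _ (free_delta_subproof x).

Lemma free_deltaE x y : free_coef (free_delta x) y = (y == x)%:R.
Proof. by []. Qed.

Section Lift.
Variables (M : lmodType R) (t : X -> M).

Lemma free_supp (f : free) :
  exists2 s : seq X, uniq s & forall x, x \notin s -> free_coef f x = 0.
Proof.
have /asboolP/finite_seqP[s fs] := valP f.
exists (undup s) => [|x]; first exact: undup_uniq.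
rewrite mem_undup; apply: contraNeq => fx.
by have : [set` s] x by rewrite -fs.
Qed.

Definition free_lift_fun (f : free) : M :=
  let s := s2val (cid2 (free_supp f)) in \sum_(x <- s) free_coef f x *: t x.

(** Both [s] and the list selected in [free_lift_fun] contain the support, so both sums reduce to
    the common part of the two lists. *)
Lemma free_lift_funE (f : free) (s : seq X) : uniq s ->
    (forall x, x \notin s -> free_coef f x = 0) ->
  free_lift_fun f = \sum_(x <- s) free_coef f x *: t x.
Proof.
move=> s_uniq sP; rewrite /free_lift_fun.
case: cid2 => /= s' s'_uniq s'P.
rewrite (bigID (mem s)) [RHS](bigID (mem s')) /=.
rewrite [X in _ + X]big1 => [|x /sP->]; last by rewrite scale0r.
rewrite [X in _ = _ + X]big1 => [|x /s'P->]; last by rewrite scale0r.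
rewrite !addr0 -[LHS]big_filter -[RHS]big_filter.
apply: perm_big; apply: uniq_perm.
- exact: filter_uniq.
- exact: filter_uniq.
- by move=> x; rewrite !mem_filter andbC.
Qed.

Fact free_lift_linear : linear free_lift_fun.
Proof.
move=> a f g.
have [s s_uniq sP] := free_supp f; have [s' s'_uniq s'P] := free_supp g.
have uP : uniq (undup (s ++ s')) by exact: undup_uniq.
have sU x : x \notin undup (s ++ s') -> (x \notin s) /\ (x \notin s').
  by rewrite mem_undup mem_cat negb_or => /andP[].
have fU x : x \notin undup (s ++ s') -> free_coef f x = 0 by move=> /sU[/sP].
have gU x : x \notin undup (s ++ s') -> free_coef g x = 0.
  by move=> /sU[_ /s'P].
have fgU x : x \notin undup (s ++ s') -> free_coef (a *: f + g) x = 0.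
  by move=> xU; rewrite free_coefP fU // gU // mulr0 addr0.
rewrite (free_lift_funE uP fgU) (free_lift_funE uP fU) (free_lift_funE uP gU).
rewrite scaler_sumr -big_split; apply: eq_bigr => x _.
by rewrite free_coefP scalerDl scalerA.
Qed.

Definition free_lift : {linear free -> M} := linear_map free_lift_linear.

Lemma free_lift_delta x : free_lift (free_delta x) = t x.
Proof.
rewrite -[LHS]/(free_lift_fun _) (@free_lift_funE _ [:: x]) //.
  by rewrite big_seq1 free_deltaE eqxx scale1r.
by move=> y; rewrite inE free_deltaE => /negbTE->.
Qed.

End Lift.

Lemma free_ind (P : free -> Prop) :
    P 0 -> (forall a x f, P f -> P (a *: free_delta x + f)) ->
  forall f, P f.
Proof.
move=> P0 PD f; have [s s_uniq sP] := free_supp f.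
have -> : f = \sum_(x <- s) free_coef f x *: free_delta x.
  have sumE (r : seq X) (c : X -> R) y :
      free_coef (\sum_(x <- r) c x *: free_delta x) y =
      \sum_(x <- r) c x * (y == x)%:R.
    elim: r => [|x r IHr]; first by rewrite !big_nil.
    by rewrite !big_cons free_coefP IHr free_deltaE.
  apply: free_ext => y; rewrite sumE.
  have [ys|ys] := boolP (y \in s).
    rewrite (bigD1_seq y) //= eqxx mulr1 big1 ?addr0 // => x.
    by rewrite eq_sym => /negbTE->; rewrite mulr0.
  rewrite sP // big_seq big1 // => x xs; case: eqVneq => [yx|_].
    by rewrite yx xs in ys.
  by rewrite mulr0.
by elim: s {s_uniq sP} => [|x s IHs]; rewrite ?big_nil ?big_cons //; exact: PD.
Qed.

Lemma free_delta_basis : is_basis (range free_delta).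
Proof.
split.
  apply/seteqP; split=> // f _ N NP.
  elim/free_ind: f => [|a x f fN]; first exact: rpred0.
  by apply: rpredD fN; apply/rpredZ/NP; exists x.
move=> s a s_uniq sB sum0 x xs.
have [y _ yx] := sB x xs.
have : free_coef (\sum_(z <- s) a z *: z) y = 0 by rewrite sum0.
have sumE (r : seq free) :
    free_coef (\sum_(z <- r) a z *: z) y = \sum_(z <- r) a z * free_coef z y.
  elim: r => [|z r IHr]; first by rewrite !big_nil.
  by rewrite !big_cons free_coefP IHr.
rewrite sumE (bigD1_seq x) //= -{2}yx free_deltaE eqxx mulr1.
rewrite big_seq_cond big1 ?addr0 // => z /andP[/sB[w _ <-] zx].
rewrite free_deltaE; case: eqVneq => [yw|_]; last by rewrite mulr0.
by rewrite -yx yw eqxx in zx.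
Qed.

End FreeModule.

(** * The canonical presentation of a module, with all its elements as generators *)

Section Relations.
Variables (R : pzRingType) (X : lmodType R).

(** The defect of linearity of [free_delta R] at [(a, x, y)]; one family covers both addition and
    scaling. *)
Definition lin_rel (a : R) (x y : X) : free R X :=
  a *: free_delta R x + free_delta R y - free_delta R (a *: x + y).

Definition free_cover : {linear free R X -> X} := free_lift (@id X).

Lemma free_coverE x : free_cover (free_delta R x) = x.
Proof. exact: free_lift_delta. Qed.

Lemma free_cover_rel a x y : free_cover (lin_rel a x y) = 0.
Proof. by rewrite /lin_rel linearB linearP !free_coverE subrr. Qed.

Definition lin_rels : set (free R X) :=
  [set f | exists a x y, f = lin_rel a x y].

(** Modulo the relations, each [f] collapses to the single basis vector at [free_cover f], by
    induction on [f]. On the kernel this is the vector at 0, which equals [lin_rel 1 0 0]. *)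
Lemma ker_free_cover :
  [set f | free_cover f = 0] = submod_gen lin_rels.
Proof.
apply/seteqP; split=> f.
  rewrite -[[set f | _] f]/(free_cover f = 0) => f0 N NP.
  have relN a x y : lin_rel a x y \in N by apply: NP; exists a, x, y.
  have d0N : free_delta R (0 : X) \in N.
    have := relN 1 0 0.
    by rewrite /lin_rel !scale1r addr0 addrK.
  suff : f - free_delta R (free_cover f) \in N.
    by move=> /rpredD/(_ d0N); rewrite f0 subrK.
  elim/free_ind: f {f0} => [|a x f fN].
    by rewrite linear0 sub0r -scaleN1r rpredZ.
  have -> : a *: free_delta R x + f -
      free_delta R (free_cover (a *: free_delta R x + f)) =
      lin_rel a x (free_cover f) + (f - free_delta R (free_cover f)).
    rewrite /lin_rel linearP free_coverE [RHS]addrAC; congr (_ - _).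
    by rewrite -addrA subrKC.
  exact: rpredD.
move=> fP.
pose P : pred (free R X) := fun f => free_cover f == 0.
have PC : submod_closed P.
  split=> [|a g h /eqP g0 /eqP h0]; first by apply/eqP; rewrite linear0.
  by apply/eqP; rewrite linearP g0 h0 scaler0 addr0.
apply/eqP; apply: (fP (submod_of PC)) => _ [a [x [y ->]]].
by apply/eqP/free_cover_rel.
Qed.

End Relations.
Arguments lin_rels {R} X _.

(** * Ext^1 = 0 as the splitting of all extensions *)

Section ExtVanishing.
Variable R : pzRingType.
Implicit Types X C : lmodType R.

Definition ext_vanishes X C : Prop := forall E : extension X C,
  exists s : {linear X -> ext_mod E}, forall x, ext_out E (s x) = x.

Lemma ext_congr_split X C (E : extension X C) :
  ext_congr E (split_extension X C) <->
  exists s : {linear X -> ext_mod E}, forall x, ext_out E (s x) = x.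
Proof.
split=> [[f [f_in f_out]]|[s sP]].
  have /choice[s sP] x :
      exists e, f e = (0, x) :> ext_mod (split_extension X C).
    have [e eP] := ext_out_surj E x; exists (e - ext_in E (f e).1).
    rewrite linearB f_in /split_in.
    have := f_out e; rewrite eP => /= <-.
    by case: (f e) => c y /=; congr pair; rewrite ?subrr ?subr0.
  (* Injectivity makes the chosen preimages [s x] of [(0, x)] depend linearly on [x]. *)
  have f_inj : injective f.
    move=> e e' fee'; apply/eqP; rewrite -subr_eq0; apply/eqP.
    have [|c cP] := (ext_exact E (e - e')).1.
      by rewrite -f_out linearB fee' subrr linear0.
    have : f (e - e') = 0 by rewrite linearB fee' subrr.
    by rewrite -cP f_in => -[->]; rewrite linear0.
  have s_lin : linear s.
    move=> a x y; apply: f_inj; rewrite linearP !sP.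
    by congr pair; rewrite /= ?scaler0 ?addr0.
  exists (linear_map s_lin) => x; rewrite -f_out -[linear_map _ x]/(s x).
  by rewrite sP.
have rP e : exists c, ext_in E c = e - s (ext_out E e).
  by apply/ext_exact; rewrite linearB sP subrr.
have /choice[r rE] := rP.
have g_lin :
    linear (fun e => (r e, ext_out E e) : ext_mod (split_extension X C)).
  move=> a e e'; congr pair; last by rewrite linearP.
  apply: (ext_in_inj E); rewrite [RHS]linearP !rE !linearP /=.
  by rewrite scalerDr addrACA.
exists (linear_map g_lin); split=> // c.
have out0 : ext_out E (ext_in E c) = 0 by apply/ext_exact; exists c.
congr pair; last by [].
by apply: (ext_in_inj E); rewrite rE out0 linear0 subr0.
Qed.

Lemma Ext1_trivial X C :
  (forall e : Ext1 X C, e = Ext1_zero X C) <-> ext_vanishes X C.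
Proof.
split=> [E0 E|E0 [P PE]].
  apply/ext_congr_split.
  have /(congr1 sval)/= PE := E0 (exist _ (ext_congr E) (ex_intro _ E erefl)).
  rewrite PE; exists (linear_map (f := idfun) (fun _ _ _ => erefl)).
  by [].
apply: eq_exist; case: PE => E ->.
apply/funext => E'; apply/propext.
have /ext_congr_split[f [f_in f_out]] := E0 E.
have [s sP] := E0 E.
(* Congruences out of [E] and out of the split extension are exchanged by composing with [f] or, in
   the other direction, with [(c, x) |-> ext_in E c + s x]. *)
split=> -[g [g_in g_out]].
  have h_lin : linear (fun u : C * X => g (ext_in E u.1 + s u.2)).
    move=> a u v; rewrite -linearP; congr (g _); rewrite !linearP. 
    by rewrite scalerDr addrACA.
  exists (linear_map (V := ext_mod (split_extension X C)) h_lin); split=> [c|u].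
    by rewrite -g_in; congr (g _); rewrite linear0 addr0.
  rewrite g_out linearD sP (_ : ext_out E _ = 0) ?add0r //.
  by apply/ext_exact; exists u.1.
have gf_lin : linear (g \o f) by move=> a u v /=; rewrite !linearP.
exists (linear_map gf_lin); split=> [c|e].
  by rewrite -g_in -f_in.
by rewrite -f_out -g_out.
Qed.

Lemma perpP (P : lmodType R -> Prop) X :
  perp P X <-> forall C, P C -> ext_vanishes X C.
Proof. by split=> PX C /PX/Ext1_trivial. Qed.

End ExtVanishing.

(** A map on a submodule is encoded as a total function with arbitrary values elsewhere, so that
    maps on different submodules of [V] share one type and can be glued. *)
Definition linear_on (R : pzRingType) (V W : lmodType R) (N : set V)
    (f : V -> W) : Prop :=
  forall a x y, N x -> N y -> f (a *: x + y) = a *: f x + f y.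

(** * Lifting and extending maps when Ext^1 vanishes *)

Section ExtLift.
Variables (R : pzRingType) (X C Y : lmodType R) (q : {linear Y -> X}).

Lemma ext_vanishes_lift (E : extension X C) : ext_vanishes Y C ->
  exists phi : {linear Y -> ext_mod E}, forall y, ext_out E (phi y) = q y.
Proof.
move=> YC.
(* N is the pullback of E along q. *)
pose P : pred (ext_mod E * Y) := fun u => ext_out E u.1 == q u.2.
have PC : submod_closed P.
  split=> [|a u v /eqP uP /eqP vP]; first by apply/eqP; rewrite !linear0.
  by apply/eqP; rewrite /= !linearP uP vP.
pose N : submodClosed (ext_mod E * Y)%type := submod_of PC.
have NP u : u \in N -> ext_out E u.1 = q u.2 by move=> /eqP.
have inN c : (ext_in E c, 0) \in N.
  by apply/eqP; rewrite /= linear0; apply/ext_exact; exists c.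
have i_lin : linear (fun c => exist (fun u => u \in N) _ (inN c) : submod N).
  move=> a c d; apply: val_inj; congr pair; first by rewrite linearP.
  by rewrite /= scaler0 addr0.
have p_lin : linear (fun u : submod N => (val u).2) by [].
have i_inj : injective (linear_map i_lin).
  by move=> c d /(congr1 (fun u => (val u).1))/ext_in_inj.
have p_surj y : exists u, linear_map p_lin u = y.
  have [e eP] := ext_out_surj E (q y).
  have eyN : (e, y) \in N by apply/eqP.
  by exists (exist (fun u => u \in N) _ eyN).
have ip_exact u : linear_map p_lin u = 0 <-> exists c, linear_map i_lin c = u.
  split=> [u0|[c <-] //].
  have := NP _ (valP u); rewrite [X in q X]u0 linear0.
  move=> /ext_exact[c cP]; exists c; apply: val_inj.
  by rewrite -[LHS]/(ext_in E c, 0) cP -[in LHS]u0 -surjective_pairing.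
have [s sP] := YC (Extension i_inj p_surj ip_exact).
have phi_lin : linear (fun y => (val (s y : submod N)).1).
  by move=> a x y; rewrite linearP.
exists (linear_map phi_lin) => y.
by rewrite -[X in _ = q X]sP; exact: NP (valP (s y : submod N)).
Qed.

(** By exactness [phi] carries the kernel of [q] into the copy of [C]; [tau] is this restriction,
    the obstruction to splitting [E]. *)
Lemma ext_kernel_map (E : extension X C) (phi : {linear Y -> ext_mod E}) :
    (forall y, ext_out E (phi y) = q y) ->
  exists2 tau : Y -> C, linear_on [set y | q y = 0] tau &
    forall y, q y = 0 -> ext_in E (tau y) = phi y.
Proof.
move=> phiP.
have /choice[tau tauP] y : exists c, q y = 0 -> ext_in E c = phi y.
  have [qy|] := pselect (q y = 0); last by exists 0.
  have /ext_exact[c cP] : ext_out E (phi y) = 0 by rewrite phiP.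
  by exists c.
exists tau => // a x y /= qx qy; apply: (ext_in_inj E).
by rewrite linearP !tauP // linearP // qx qy scaler0 addr0.
Qed.

(** Subtracting [h] from [phi] gives a lift of [q] that kills the defects of linearity of the
    set-theoretic section [t], so its composite with [t] is linear. *)
Lemma ext_section (E : extension X C) (phi : {linear Y -> ext_mod E})
    (h : {linear Y -> C}) (t : X -> Y) :
    (forall y, ext_out E (phi y) = q y) -> (forall x, q (t x) = x) ->
    (forall a x y (z := a *: t x + t y - t (a *: x + y)),
      ext_in E (h z) = phi z) ->
  exists s : {linear X -> ext_mod E}, forall x, ext_out E (s x) = x.
Proof.
move=> phiP qt hP.
have psi_lin : linear (fun y => phi y - ext_in E (h y)).
  move=> a x y; rewrite (linearP phi) (linearP h) (linearP (ext_in E)).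
  by rewrite opprD scalerBr addrACA.
pose psi := linear_map psi_lin.
have s_lin : linear (psi \o t).
  move=> a x y; apply/esym/eqP; rewrite -subr_eq0 -linearP -linearB.
  by rewrite -[psi _]/(phi _ - ext_in E (h _)) hP subrr.
exists (linear_map s_lin) => x.
rewrite -[linear_map _ x]/(phi (t x) - ext_in E (h (t x))) linearB phiP qt.
by rewrite (_ : ext_out E (ext_in E _) = 0) ?subr0 //; apply/ext_exact; eexists.
Qed.

(** Exactness of Hom(Y, C) -> Hom(ker q, C) -> Ext^1(X, C). For a section [s] of the pushout, [h y]
    is the element of [C] representing [(0, y) - s (q y)]. *)
Lemma ext_vanishes_extend (tau : Y -> C) :
    (forall x, exists y, q y = x) -> ext_vanishes X C ->
    linear_on [set y | q y = 0] tau ->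
  exists h : {linear Y -> C}, forall y, q y = 0 -> h y = tau y.
Proof.
move=> q_surj XC tau_lin.
have tau0 : tau 0 = 0.
  have q0 : q 0 = 0 := linear0 q.
  have := tau_lin (-1) 0 0 q0 q0.
  by rewrite scaler0 addr0 scaleN1r addNr.
(* (C * Y) / N is the pushout of ker q -> Y along tau. *)
pose P : pred (C * Y) := fun u => (q u.2 == 0) && (u.1 == - tau u.2).
have PC : submod_closed P.
  split=> [|a u v /andP[/eqP u2 /eqP u1] /andP[/eqP v2 /eqP v1]].
    by apply/andP; rewrite /= linear0 tau0 oppr0.
  apply/andP; rewrite /= linearP u2 v2 scaler0 addr0 tau_lin // u1 v1.
  by rewrite opprD scalerN.
pose N : submodClosed (C * Y)%type := submod_of PC.
pose pi := quot_proj N.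
have i_lin : linear (fun c => pi (c, 0)).
  move=> a c d; rewrite -(linearP pi); congr (pi (_, _)).
  by rewrite /= scaler0 addr0.
have p_lin : linear (fun u : quotmod N => q (repr u).2).
  move=> a u v; rewrite -linearP; apply/eqP; rewrite -subr_eq0 -linearB.
  have : pi (repr (a *: u + v)) = pi (a *: repr u + repr v).
    by rewrite linearP !quot_proj_repr.
  by move=> /quot_proj_eq /andP[].
have p_pi u : linear_map p_lin (pi u) = q u.2.
  rewrite -[LHS]/(q (repr (pi u)).2); apply/eqP; rewrite -subr_eq0 -linearB.
  have : pi (repr (pi u)) = pi u by rewrite quot_proj_repr.
  by move=> /quot_proj_eq /andP[].
have i_inj : injective (linear_map i_lin).
  move=> c d /quot_proj_eq /andP[_ /eqP /=].
  by rewrite subr0 tau0 oppr0 => /eqP; rewrite subr_eq0 => /eqP.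
have p_surj x : exists u, linear_map p_lin u = x.
  by have [y <-] := q_surj x; exists (pi (0, y)); rewrite p_pi.
have ip_exact u : linear_map p_lin u = 0 <-> exists c, linear_map i_lin c = u.
  split=> [|[c <-]]; last by rewrite p_pi linear0.
  have -> : u = pi (repr u) by rewrite quot_proj_repr.
  (* [N] contains [(tau y, - y)], which moves [(c, y)] to [(c + tau y, 0)]. *)
  case: (repr u) => c y; rewrite p_pi /= => qy; exists (c + tau y).
  apply/quot_proj_eq/andP; split; rewrite /= sub0r.
    by rewrite linearN qy oppr0.
  have := tau_lin (-1) y 0 qy (linear0 q).
  by rewrite !scaleN1r tau0 !addr0 => ->; rewrite opprK addrAC subrr add0r.
have [s sP] := XC (Extension i_inj p_surj ip_exact).
have /choice[h hP] y : exists c, pi (c, 0) = pi (0, y) - (s (q y) : quotmod N).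
  by apply/ip_exact; rewrite linearB [X in _ - X]sP p_pi subrr.
have h_lin : linear h.
  move=> a x y; apply: (i_inj); rewrite linearP.
  rewrite -[linear_map _ _]/(pi (_, 0)).
  rewrite -[linear_map _ (h x)]/(pi (_, 0)) -[linear_map _ (h y)]/(pi (_, 0)).
  rewrite !hP linearP (linearP s) scalerDr addrACA scalerN -opprD.
  rewrite -(linearP pi); congr (pi _ - _).
  by congr pair; rewrite /= ?scaler0 ?addr0.
exists (linear_map h_lin) => y qy; apply: (i_inj).
rewrite -[LHS]/(pi (_, 0)) hP qy linear0 subr0; apply/quot_proj_eq/andP.
by split; rewrite /= subr0 ?qy // sub0r.
Qed.

End ExtLift.

(** Freeness lifts [free_cover] to [E], which leaves [tau] on the kernel to be corrected. Agreement
    is asked only on the relations, where a normal measure can provide it. *)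
Lemma ext_vanishes_rel (R : pzRingType) (X C : lmodType R) :
    (forall tau : free R X -> C, linear_on [set f | free_cover X f = 0] tau ->
      exists h : {linear free R X -> C}, forall a x y,
        h (lin_rel a x y) = tau (lin_rel a x y)) ->
  ext_vanishes X C.
Proof.
move=> tauP E.
have /choice[t tP] := ext_out_surj E.
have liftP f : ext_out E (free_lift t f) = free_cover X f.
  elim/free_ind: f => [|a x f IHf]; first by rewrite !linear0.
  by rewrite !linearP IHf free_lift_delta tP free_coverE.
have [tau tau_lin tauE] := ext_kernel_map liftP.
have [h hP] := tauP tau tau_lin.
apply: (ext_section (h := h) (t := free_delta R (X := X)) liftP).
  exact: free_coverE.
move=> a x y z; rewrite -[z]/(lin_rel a x y) hP.
exact/tauE/free_cover_rel.
Qed.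

(** Exactness of Hom(X, C) -> Hom(N, C) -> Ext^1(X/N, C) -> Ext^1(X, C). *)
Lemma ext_vanishes_quotmod (R : pzRingType) (X C : lmodType R)
    (N : submodClosed X) : ext_vanishes X C ->
    (forall f : X -> C, linear_on [set` N] f ->
      exists h : {linear X -> C}, forall x, x \in N -> h x = f x) ->
  ext_vanishes (quotmod N) C.
Proof.
move=> XC ext_f E.
have proj0 x : quot_proj N x = 0 <-> x \in N.
  by rewrite -[in x \in N](subr0 x) -quot_proj_eq linear0.
have [phi phiP] := ext_vanishes_lift (quot_proj N) E XC.
have [tau tau_lin tauE] := ext_kernel_map phiP.
have [|h hP] := ext_f tau.
  by move=> a x y xN yN; apply: tau_lin; apply/proj0.
apply: (ext_section (h := h) (t := fun u : quotmod N => repr u : X) phiP).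
  exact: quot_proj_repr.
move=> a u v z.
have zN : z \in N.
  by apply/proj0; rewrite linearB linearP !quot_proj_repr subrr.
by rewrite hP // tauE //; exact/proj0.
Qed.

Lemma lt_presented_rels (R : pzRingType) (K : choiceType) (M : lmodType R) :
  [set: M] #< [set: K] -> lin_rels M #< [set: K] -> lt_presented K M.
Proof.
move=> M_lt rels_lt.
exists (free R M), (range (free_delta R (X := M))), (free_cover M).
exists (lin_rels M).
split=> //.
- exact: free_delta_basis.
- exact: card_lt_le (card_image_le _ _) M_lt.
- apply/seteqP; split=> // x _; exists (free_delta R x) => //.
  exact: free_coverE.
- exact: ker_free_cover.
Qed.

(** * Submodules of [C] cut out by a normal measure *)

Section Trace.
Variables (R : pzRingType) (K : choiceType) (C : lmodType R).

(* The summand K ensures |A| >= kappa.  The triples index the relations of the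
   canonical presentation of a submodule, so that a closed x bounds their
   number without any cardinal arithmetic. *)
Let A : choiceType := (K + C + R * C * C)%type.

Variable U : set_system (Pkappa K A).
Hypotheses (nU : normal_measure U) (R_lt : [set: R] #< [set: K]).

#[local] Instance trace_filter : ProperFilter U := measure_filter nU.

Definition trace (x : Pkappa K A) : set C := [set c | sval x (inl (inr c))].

Lemma trace_mem c : U [set x | trace x c].
Proof. exact: measure_fine nU _. Qed.

Lemma trace_diag (P : C -> Pkappa K A -> Prop) :
  (forall c, U [set x | P c x]) -> U [set x | forall c, trace x c -> P c x].
Proof.
move=> UP.
have : U [set x | forall a, sval x a ->
    if a is inl (inr c) then P c x else True].
  by apply: (measure_diag nU) => -[[k|c]|t] //; exact: filterT.
by apply: filterS => x Px c /Px.
Qed.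

(** Normality handles [c] and [d], which range over the trace; completeness handles [a], which
    ranges over all of [R]. *)
Lemma trace_diag2 (P : R -> C -> C -> Pkappa K A -> Prop) :
    (forall a c d, U [set x | P a c d x]) ->
  U [set x | forall a c d, trace x c -> trace x d -> P a c d x].
Proof.
move=> UP.
have : U [set x | forall c, trace x c -> forall d, trace x d ->
    forall a, [set: R] a -> P a c d x].
  apply: trace_diag => c; apply: trace_diag => d.
  by apply: (measure_all nU) R_lt _ => a _; exact: UP.
by apply: filterS => x Px a c d xc xd; exact: Px.
Qed.

Lemma trace_rel : U [set x | forall a c d, trace x c -> trace x d ->
  sval x (inr (a, c, d))].
Proof. by apply: trace_diag2 => a c d; exact: measure_fine nU _. Qed.

Let tracep (x : Pkappa K A) : pred C := fun c => `[< trace x c >].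

Fact predT_submod_closed : submod_closed (predT : pred C).
Proof. by []. Qed.

(** The default value, all of [C], makes this total; it occurs only on a null set. *)
Definition trace_mod (x : Pkappa K A) : submodClosed C :=
  match pselect (submod_closed (tracep x)) with
  | left xP => submod_of xP
  | right _ => submod_of predT_submod_closed
  end.

Lemma trace_modP : U [set x | forall c, c \in trace_mod x <-> trace x c].
Proof.
have : U [set x | forall a c d, trace x c -> trace x d -> trace x (a *: c + d)].
  by apply: trace_diag2 => a c d; exact: trace_mem.
apply: filterS2 (trace_mem 0) => x x0 xP c; rewrite /trace_mod.
case: pselect => [xC|[]]; first by split=> /asboolP.
split=> [|a d e /asboolP xd /asboolP xe]; first exact/asboolP.
by apply/asboolP; exact: xP.
Qed.

Section Target.
Variable S : lmodType R.
Hypotheses (S_lt : [set: S] #< [set: K]) (CS : ext_vanishes C S).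

(** Completeness gives the values point by point; the measure-one set still depends on [m]. *)
Lemma paste (M : Type) (f : Pkappa K A -> M -> S) :
  exists g : M -> S, forall m, U [set x | f x m = g m].
Proof.
have /choice[g gP] m : exists s, U [set x | f x m = s].
  exact: measure_const.
by exists g.
Qed.

Lemma trace_extend : U [set x | forall f : C -> S, linear_on (trace x) f ->
  exists h : {linear C -> S}, forall c, trace x c -> h c = f c].
Proof.
pose ext x f := exists h : {linear C -> S}, forall c, trace x c -> h c = f c.
(* [f x] is a map that does not extend whenever there is one, so extending it alone settles all maps
   on [trace x]. *)
have /choice[f fP] x : exists f : C -> S, linear_on (trace x) f /\
    (ext x f -> forall f', linear_on (trace x) f' -> ext x f').
  have [all_ext|] := pselect (forall f', linear_on (trace x) f' -> ext x f').
    by exists (fun=> 0); split=> // a c d; rewrite scaler0 addr0.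
  move=> /existsNP[f /not_implyP[f_lin nf]].
  by exists f; split.
have [g gP] := paste f.
have g_lin : linear g.
  move=> a c d.
  have [x [[xc xd] [[/= <- <-] <-]]] := filter_ex (filterI
    (filterI (trace_mem c) (trace_mem d))
    (filterI (filterI (gP (a *: c + d)) (gP c)) (gP d))).
  exact: (fP x).1.
(* Normality turns agreement at each [c] into agreement on the whole trace. *)
have : U [set x | forall c, trace x c -> f x c = g c] by exact: trace_diag.
apply: filterS => x fg; apply: (fP x).2.
by exists (linear_map g_lin) => c /fg.
Qed.

Lemma trace_ext_vanishes : U [set x | ext_vanishes (submod (trace_mod x)) S].
Proof.
pose F x := free R (submod (trace_mod x)).
(* [tau x] refutes the criterion [ext_vanishes_rel] whenever Ext does not vanish at [x]. *)
have tau_ex x : exists tau : F x -> S,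
    linear_on [set f | free_cover _ f = 0] tau /\
    ((exists h : {linear F x -> S}, forall a c d,
      h (lin_rel a c d) = tau (lin_rel a c d)) ->
    ext_vanishes (submod (trace_mod x)) S).
  have [v|nv] := pselect (ext_vanishes (submod (trace_mod x)) S).
    by exists (fun=> 0); split=> // a c d; rewrite scaler0 addr0.
  apply: contrapT => ntau; apply: nv; apply: ext_vanishes_rel => tau tau_lin.
  by apply: contrapT => ntau'; apply: ntau; exists tau; split.
pose tau x := projT1 (cid (tau_ex x)).
have tauP x := projT2 (cid (tau_ex x)); rewrite -/(tau _) in tauP.
(* The [F x] vary, so they are compared with the fixed [free R C]. Basis vectors outside the
   submodule go to the one at 0; a given [f] involves finitely many basis vectors, all inside for
   almost every [x]. *)
pose restr x : {linear free R C -> F x} :=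
  free_lift (fun c => free_delta R (insubd (0 : submod (trace_mod x)) c)).
have restr_cover f :
    U [set x | val (free_cover _ (restr x f)) = free_cover C f].
  elim/free_ind: f => [|a c f IHf].
    by apply: filterE => x; rewrite mksetE !linear0.
  apply: filterS3 IHf (trace_mem c) trace_modP => x.
  rewrite mksetE => fP xc xP.
  rewrite mksetE !linearP free_lift_delta !free_coverE.
  by congr (_ *: _ + _); first exact/insubdK/xP.
have [g gP] := paste (fun x f => tau x (restr x f)).
have g_lin : linear_on [set f | free_cover C f = 0] g.
  move=> a f f' f0 f'0.
  (* For almost every [x], [restr x] sends [f] and [f'] into the kernel on which [tau x] is
     linear. *)
  have [x [[xf xf'] [[<- <-] <-]]] := filter_ex (filterI
    (filterI (restr_cover f) (restr_cover f'))
    (filterI (filterI (gP (a *: f + f')) (gP f)) (gP f'))).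
  rewrite linearP; apply: (tauP x).1; apply: val_inj.
    by rewrite /= xf f0.
  by rewrite /= xf' f'0.
have [|h hP] := ext_vanishes_extend _ CS g_lin.
  by move=> c; exists (free_delta R c); exact: free_coverE.
have : U [set x | forall a c d, trace x c -> trace x d ->
    tau x (restr x (lin_rel a c d)) = g (lin_rel a c d)].
  by apply: trace_diag2 => a c d; exact: gP.
apply: filterS2 trace_modP => x xP tau_g; apply: (tauP x).2.
(* [restr x] undoes [incl] on basis vectors, so [h \o incl] agrees with [tau x] on the relations. *)
pose incl : {linear F x -> free R C} :=
  free_lift (fun n : submod (trace_mod x) => free_delta R (val n)).
have h_lin : linear (h \o incl).
  by move=> a u v; rewrite -[LHS]/(h (incl _)) !linearP.
exists (linear_map h_lin) => a c d; rewrite -[LHS]/(h (incl _)).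
have -> : incl (lin_rel a c d) = lin_rel a (val c) (val d).
  by rewrite /lin_rel linearB linearP !free_lift_delta.
rewrite hP ?free_cover_rel // -tau_g; [|exact/xP/valP|exact/xP/valP].
congr (tau x _); rewrite /lin_rel linearB linearP !free_lift_delta.
by rewrite -[a *: val c + val d]/(val (a *: c + d)) !valKd.
Qed.

End Target.

Lemma trace_lt x : trace x #< [set: K].
Proof.
apply: card_lt_le (svalP x).
by apply: (@card_le_inj _ _ (fun c => inl (inr c))) => [c d _ _ []|_ [c xc <-]].
Qed.

Lemma trace_lt_presented : U [set x | lt_presented K (submod (trace_mod x))].
Proof.
apply: filterS2 trace_modP trace_rel => x xP xrel.
apply: lt_presented_rels.
  apply: card_lt_le (trace_lt x); apply: (@card_le_inj _ _ val).
    by move=> c d _ _; exact: val_inj.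
  by move=> _ [c _ <-]; exact/xP/valP.
apply: card_lt_le (svalP x).
pose T := [set t : R * C * C | sval x (inr t)].
apply: (@card_le_trans _ _ _ T); last first.
  by apply: (@card_le_inj _ _ inr) => [t u _ _ []|_ [t xt <-]].
(* The default 0 makes [rel] total; its image of [T] only has to contain all relations. *)
pose rel (t : R * C * C) := lin_rel t.1.1
  (insubd (0 : submod (trace_mod x)) t.1.2) (insubd 0 t.2).
apply: card_le_trans (card_image_le rel T); apply: subset_card_le.
move=> _ [a [c [d ->]]]; exists (a, val c, val d).
  by apply: xrel; exact/xP/valP.
by rewrite /rel !valKd.
Qed.

End Trace.

(** * Choice of kappa and of the submodule *)

Theorem theorem1p6 (supercompacts : proper_class_of_supercompacts)
    (R : pzRingType) (I : choiceType) (S : I -> lmodType R) :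
  kaplansky_class (perp (fun M => exists i : I, S i = M)).
Proof.
(* A kappa above this disjoint union exceeds [R], [I] and every [S i] at once. *)
have [K [[K_unc K_sc] lt_K]] := supercompacts (R + I + {i : I & S i})%type.
have lt_inj (T : Type) (f : T -> R + I + {i : I & S i}) :
    injective f -> [set: T] #< [set: K].
  move=> f_inj; apply: card_lt_le lt_K.
  by apply: (@card_le_inj _ _ f) => // x y _ _ /f_inj.
have R_lt : [set: R] #< [set: K] by apply: (lt_inj R (inl \o inl)) => a b [].
have I_lt : [set: I] #< [set: K] by apply: (lt_inj I (inl \o inr)) => a b [].
have S_lt i : [set: S i] #< [set: K].
  apply: (lt_inj (S i) (fun s => inr (existT _ i s))) => a b [].
  by move=> /eqP; rewrite eq_Tagged => /eqP.
exists K => [|C /perpP CS X X_lt].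
  by move=> K_fin; apply: K_unc; exact: finite_set_countable.
have [|U nU] := K_sc (K + C + R * C * C)%type.
  by apply: (@card_le_inj _ _ (inl \o inl)) => // a b _ _ [].
have ? := measure_filter nU.
have {}CS i : ext_vanishes C (S i) by apply: CS; exists i.
have : U [set x | forall c, X c -> trace x c].
  by apply: (measure_all nU) X_lt _ => c _; exact: trace_mem.
(* As [I] is smaller than kappa, completeness treats all targets simultaneously. *)
have : U [set x | forall i, [set: I] i ->
    ext_vanishes (submod (trace_mod x)) (S i) /\
    forall f : C -> S i, linear_on (trace x) f ->
      exists h : {linear C -> S i}, forall c, trace x c -> h c = f c].
  apply: (measure_all nU) I_lt _ => i _.
  apply: filterI; first exact: trace_ext_vanishes.
  exact: trace_extend.
move=> UI UX.
have [x [[xI xX] [xP x_pres]]] := filter_ex (filterI (filterI UI UX)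
  (filterI (trace_modP nU R_lt) (trace_lt_presented nU R_lt))).
exists (trace_mod x); split=> //.
- by move=> c /xX /xP.
- by apply/perpP => _ [i <-]; exact: (xI i _).1.
- apply/perpP => _ [i <-]; apply: ext_vanishes_quotmod => // f f_lin.
  have [//||h hP] := (xI i _).2 f.
    by move=> a c d /xP xc /xP xd; exact: f_lin.
  by exists h => c /xP; exact: hP.
Qed.
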